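(* Let $m,n,k_1,\dots,k_m,l_1,\dots,l_n$ be positive integers. Then for any integer $j$ with $1\le j\le m$, $$ \begin{aligned} z_{k_1}z_{k_2}\cdots z_{k_m}\overset{t}{\ast} z_{l_1}z_{l_2}\cdots z_{l_n} =\sum_{i=0}^{n}\Big[&\big(z_{k_1}\cdots z_{k_{j-1}}\overset{t}{\ast}_o z_{l_1}\cdots z_{l_i}\big)z_{k_j}\\ &+\big(z_{k_1}\cdots z_{k_{j-1}}\overset{t}{\ast}_o z_{l_1}\cdots z_{l_{i-1}}\big)\big\{(1-2t)z_{k_j+l_i}+(1-\delta_{i,n}\delta_{j,m})(t^2-t)x^{k_j+l_i}\big\}\Big]\\ &\times\big(z_{k_{j+1}}\cdots z_{k_m}\overset{t}{\ast} z_{l_{i+1}}\cdots z_{l_n}\big), \end{aligned} $$ where $z_{k_i}\cdots z_{k_{i-1}}=z_{l_i}\cdots z_{l_{i-1}}=1$ and $z_{k_i}\cdots z_{k_{i-2}}=z_{l_i}\cdots z_{l_{i-2}}=0$ for any integer $i$ (so, in particular, the second summand in the bracket is $0$ for $i=0$), and $\delta_{i,j}$ is Kronecker's delta.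
   Context: Let $A=\{x,y\}$ be two noncommuting letters, $A^*$ the set of all words in $A$ including the empty word $1$, and $\mathfrak{h}_t=\mathbb{Q}[t]\langle A\rangle$ the noncommutative polynomial algebra over $\mathbb{Q}[t]$ generated by $A$ (product = concatenation). Put $\mathfrak{h}_t^1=\mathbb{Q}[t]+\mathfrak{h}_t y$ and, for each positive integer $k$, $z_k=x^{k-1}y$. The t-stuffle product $\overset{t}{\ast}$ on $\mathfrak{h}_t^1$ is the $\mathbb{Q}[t]$-bilinear product determined by: (i) $1\overset{t}{\ast}w=w\overset{t}{\ast}1=w$; (ii) $$z_kw_1\overset{t}{\ast} z_lw_2 = z_k(w_1\overset{t}{\ast} z_lw_2) + z_l(z_kw_1\overset{t}{\ast} w_2)+(1-2t)z_{k+l}(w_1\overset{t}{\ast} w_2)+ [1-\delta(w_1)\delta(w_2)](t^2-t)x^{k+l}(w_1\overset{t}{\ast} w_2)$$ for all words $w,w_1,w_2\in A^*\cap\mathfrak{h}_t^1$ and all positive integers $k,l$, where $\delta(w)=1$ if $w=1$ and $\delta(w)=0$ otherwise. The product $\overset{t}{\ast}_o:\mathfrak{h}_t^1\times\mathfrak{h}_t^1\to\mathfrak{h}_t$ is the $\mathbb{Q}[t]$-bilinear map determined by $1\overset{t}{\ast}_o w=w\overset{t}{\ast}_o 1=w$ and $$z_kw_1\overset{t}{\ast}_o z_lw_2 = z_k(w_1\overset{t}{\ast}_o z_lw_2) + z_l(z_kw_1\overset{t}{\ast}_o w_2)+\{(1-2t)z_{k+l}+(t^2-t)x^{k+l}\}(w_1\overset{t}{\ast}_o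 w_2)$$ for words $w,w_1,w_2\in A^*\cap\mathfrak{h}_t^1$ and positive integers $k,l$. *)

(* Defs.v *)
From HB Require Import structures.
From mathcomp Require Import all_boot all_order all_algebra.
From mathcomp Require Import finmap.
From mathcomp.multinomials Require Import monalg.

Set Implicit Arguments.
Unset Strict Implicit.
Unset Printing Implicit Defensive.

Import GRing.Theory.
Local Open Scope ring_scope.

Variant letter := lx | ly.

Definition letter_is_y (a : letter) : bool := if a is ly then true else false.
Definition letter_of_bool (b : bool) : letter := if b then ly else lx.
Lemma letter_is_yK : cancel letter_is_y letter_of_bool. Proof. by case. Qed.
HB.instance Definition _ := Choice.copy letter (can_type letter_is_yK).

Notation Qt := {poly rat}.
(* Words are bare sequences rather than {fmonom letter}, on whose monoid
   algebra failing unification problems between products may not return. *)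
Notation word := (seq letter).
Lemma cat_eq_nil (u v : word) : u ++ v = [::] -> u = [::] /\ v = [::].
Proof. by case: u. Qed.
HB.instance Definition _ := Choice_isMonomialDef.Build word
  (@catA letter) (@cat0s letter) (@cats0 letter) cat_eq_nil.

Notation ht := {malg Qt[word]}.

Definition t : Qt := 'X.
Definition xh : ht := << [:: lx] >>.
Definition yh : ht := << [:: ly] >>.

(* z_k = x^(k-1) y; only meaningful for k > 0 (z 0 is a junk value). *)
Definition z (k : nat) : ht := xh ^+ k.-1 * yh.

Definition in_ht1 (u : ht) : Prop := exists (c : Qt) (v : ht), u = c%:MP + v * yh.

(* The words of ht1: the empty word and the words ending in y. *)
Definition word1 (w : word) : bool := last ly w == ly.

Definition zprod (ks : seq nat) : ht := \prod_(k <- ks) z k.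

(* [indices w] is the list [:: k_1; ...; k_r] of positive integers such that
   w = z_{k_1} ... z_{k_r}, provided that w is a word of ht1; the counter k is
   one more than the number of letters x read since the last y. *)
Fixpoint indices_from (k : nat) (w : word) : seq nat :=
  match w with
  | [::] => [::]
  | lx :: w' => indices_from k.+1 w'
  | ly :: w' => k :: indices_from 1 w'
  end.
Definition indices (w : word) : seq nat := indices_from 1 w.

Definition delta (T : Type) (s : seq T) : Qt := (nilp s)%:R.

(* The coefficients of x^(k+l) in the recursions of the two products. *)
Definition coef_st (T : Type) (s1 s2 : seq T) : Qt :=
  (1 - delta s1 * delta s2) * (t ^+ 2 - t).
Definition coef_sto (T : Type) (s1 s2 : seq T) : Qt := t ^+ 2 - t.

Fixpoint stuffle_rec (c : seq nat -> seq nat -> Qt) (ks : seq nat) :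
    seq nat -> ht :=
  match ks with
  | [::] => zprod
  | k :: ks' =>
    fix stuffle_k (ls : seq nat) : ht :=
      match ls with
      | [::] => zprod ks
      | l :: ls' =>
          z k * stuffle_rec c ks' ls + z l * stuffle_k ls'
          + ((1 - 2%:R * t) *: z (k + l) + c ks' ls' *: xh ^+ (k + l))
            * stuffle_rec c ks' ls'
      end
  end.

Definition stuffle_word (c : seq nat -> seq nat -> Qt) (w1 w2 : word) : ht :=
  if word1 w1 && word1 w2 then stuffle_rec c (indices w1) (indices w2) else 0.

Definition bilin_ext (f : word -> word -> ht) (u v : ht) : ht :=
  \sum_(w1 <- msupp u) \sum_(w2 <- msupp v) (u@_w1 * v@_w2) *: f w1 w2.

(* The two products are extended to ht * ht, with the value 0 on the pairs of
   words that are not both in ht1. *)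
Definition tstuffle : ht -> ht -> ht :=
  bilin_ext (stuffle_word (@coef_st nat)).
Definition tstuffleo : ht -> ht -> ht :=
  bilin_ext (stuffle_word (@coef_sto nat)).

(* [zseg k a b] is z_{k_a} ... z_{k_(b-1)}: the upper bound b is EXCLUSIVE, so
   that the empty product z_{k_i} ... z_{k_(i-1)} = 1 is [zseg k i i], and
   z_{k_i} ... z_{k_(i-2)} = 0 is [zseg k i i.-1] (for i > 0). *)
Definition zseg (k : nat -> nat) (a b : nat) : ht :=
  if (b < a)%N then 0 else \prod_(a <= i < b) z (k i).

(* [tstuffle] and [tstuffleo] are, on ht1, the unique Q[t]-bilinear products
   that satisfy these rules with c = coef_st and c = coef_sto respectively: see
   [tstuffleP], [tstuffleoP] and [stuffle_rules_uniq] below. *)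
Record stuffle_rules (c : word -> word -> Qt) (f : ht -> ht -> ht) : Prop := {
  stuffle_linl : forall (a : Qt) (u u' v : ht),
    in_ht1 u -> in_ht1 u' -> in_ht1 v -> f (a *: u + u') v = a *: f u v + f u' v;
  stuffle_linr : forall (a : Qt) (u v v' : ht),
    in_ht1 u -> in_ht1 v -> in_ht1 v' -> f u (a *: v + v') = a *: f u v + f u v';
  stuffle_1w : forall w : word, in_ht1 << w >> -> f 1 << w >> = << w >>;
  stuffle_w1 : forall w : word, in_ht1 << w >> -> f << w >> 1 = << w >>;
  stuffle_zz : forall (k l : nat) (w1 w2 : word), (0 < k)%N -> (0 < l)%N ->
    in_ht1 << w1 >> -> in_ht1 << w2 >> ->
    f (z k * << w1 >>) (z l * << w2 >>)
    = z k * f << w1 >> (z l * << w2 >>) + z l * f (z k * << w1 >>) << w2 >>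
      + (1 - 2%:R * t) *: (z (k + l) * f << w1 >> << w2 >>)
      + c w1 w2 *: (xh ^+ (k + l) * f << w1 >> << w2 >>)
}.

Lemma mulUU (w1 w2 : word) : << w1 >> * << w2 >> = << w1 ++ w2 >> :> ht.
Proof. by rewrite malgM_def fgmulUU mulr1. Qed.

Lemma oneU : (1 : ht) = << [::] >>.
Proof. by []. Qed.

Lemma xhM (w : word) : xh * << w >> = << (lx :: w) >> :> ht.
Proof. by rewrite mulUU. Qed.

Lemma yhM (w : word) : yh * << w >> = << (ly :: w) >> :> ht.
Proof. by rewrite mulUU. Qed.

Lemma Myh (w : word) : << w >> * yh = << (rcons w ly) >> :> ht.
Proof. by rewrite mulUU cats1. Qed.

Lemma xhXM k (w : word) :
  xh ^+ k * << w >> = << (nseq k lx ++ w) >> :> ht.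
Proof.
elim: k => [|k IHk]; first by rewrite mul1r.
by rewrite exprS -mulrA IHk xhM.
Qed.

Definition zcons (k : nat) (w : word) : word := nseq k.-1 lx ++ ly :: w.

Lemma zM k (w : word) : z k * << w >> = << zcons k w >> :> ht.
Proof. by rewrite -mulrA yhM xhXM. Qed.

Lemma word1_zcons k w : word1 w -> word1 (zcons k w).
Proof. by rewrite /word1 /= last_cat. Qed.

Lemma indices_from_xs m k (w : word) :
  indices_from m (nseq k lx ++ w) = indices_from (k + m) w.
Proof. by elim: k m => [|k IHk] m //=; rewrite IHk addnS. Qed.

Lemma indices_zcons k w : (0 < k)%N -> indices (zcons k w) = k :: indices w.
Proof.
by move=> k0; rewrite /indices /= indices_from_xs addn1 prednK.
Qed.

Lemma zprod_cons k ks : zprod (k :: ks) = z k * zprod ks.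
Proof. by rewrite /zprod big_cons. Qed.

Definition zword (ks : seq nat) : word := foldr zcons ([::]) ks.

Lemma zprodE ks : zprod ks = << zword ks >>.
Proof.
elim: ks => [|k ks IHks]; first by rewrite /zprod big_nil oneU.
by rewrite zprod_cons IHks zM.
Qed.

Lemma word1_zword ks : word1 (zword ks).
Proof. by elim: ks => [|k ks IHks] //=; apply: word1_zcons. Qed.

Lemma indices_fromK k (w : word) : last ly w == ly ->
  (w == [::]) ==> (k == 0%N) ->
  zword (indices_from k.+1 w) = (nseq k lx ++ w).
Proof.
elim: w k => [|[] w IHw] k /=.
- by move=> _ /eqP ->.
- move=> h _; rewrite IHw; last 2 first.
  + by case: w h {IHw}.
  + by case: w h {IHw}.
  by rewrite -addn1 nseqD -catA.
- by move=> h _; rewrite IHw ?implybT.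
Qed.

Lemma indicesK (w : word) : word1 w -> zword (indices w) = w.
Proof. by move=> w1; rewrite /indices indices_fromK ?implybT. Qed.

Lemma zprod_indices (w : word) : word1 w -> zprod (indices w) = << w >>.
Proof. by move=> w1; rewrite zprodE indicesK. Qed.

Lemma indices_from_gt0 m (w : word) :
  (0 < m)%N -> all (leq 1) (indices_from m w).
Proof. by elim: w m => [|[] w IHw] m m0 //=; rewrite ?m0 /= IHw. Qed.

Lemma indices_gt0 (w : word) : all (leq 1) (indices w).
Proof. exact: indices_from_gt0. Qed.

Lemma delta_indices (w : word) : word1 w -> delta (indices w) = delta w.
Proof.
move=> w1; rewrite /delta; congr (_%:R); congr nat_of_bool.
rewrite -{2}(indicesK w1); case: (indices w) => [|k ks] //=.
by rewrite /zcons; case: k => [|[|k]].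
Qed.

Lemma in_ht1D (u v : ht) : in_ht1 u -> in_ht1 v -> in_ht1 (u + v).
Proof.
move=> [c [u' ->]] [d [v' ->]]; exists (c + d), (u' + v').
by rewrite monalgUD mulrDl addrACA.
Qed.

Lemma in_ht1Z (a : Qt) (u : ht) : in_ht1 u -> in_ht1 (a *: u).
Proof.
move=> [c [u' ->]]; exists (a * c), (a *: u').
by rewrite scalerDr -scalerAl -!mul_malgC mpolyCM.
Qed.

Lemma in_ht10 : in_ht1 0.
Proof. by exists 0, 0; rewrite mul0r addr0 malgC0E. Qed.

Lemma in_ht1U (w : word) : word1 w -> in_ht1 << w >>.
Proof.
case: (lastP w) => [_|s a].
  by exists 1, 0; rewrite mul0r addr0.
rewrite /word1 /= last_rcons => /eqP ->; exists 0, << s >>.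
by rewrite malgC0E add0r Myh.
Qed.

Lemma malgUZ (c : Qt) (w : word) : << c *g w >> = c *: << w >> :> ht.
Proof. by apply/malgP => v; rewrite mcoeffZ !mcoeffU mulrnAr mulr1. Qed.

Lemma in_ht1P (u : ht) : in_ht1 u <-> (forall w, w \in msupp u -> word1 w).
Proof.
split=> [[c [v ->]] w|u1]; last first.
  rewrite (monalgE u) big_seq.
  elim/big_rec: _ => [|w v wu v1]; first exact: in_ht10.
  by apply: in_ht1D => //; rewrite malgUZ; apply/in_ht1Z/in_ht1U/u1.
apply: contraTT => wN1; rewrite -mcoeff_eq0 mcoeffD mcoeffC.
have -> : (w == mone) = false.
  by apply: contraNF wN1 => /eqP ->.
rewrite mulr0n add0r (monalgE v) mulr_suml raddf_sum /= big1 // => s _.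
rewrite malgUZ -scalerAl Myh mcoeffZ mcoeffU.
rewrite (_ : (_ == w) = false) ?mulr0 //.
by apply: contraNF wN1 => /eqP <-; rewrite /word1 /= last_rcons.
Qed.

Lemma in_ht1UP (w : word) : in_ht1 << w >> <-> word1 w.
Proof.
split=> [/in_ht1P|]; last exact: in_ht1U.
by apply; rewrite msuppU1 in_fset1.
Qed.

Lemma bilin_extEw f (d1 d2 : {fset word}) (u v : ht) :
  (msupp u `<=` d1)%fset -> (msupp v `<=` d2)%fset ->
  bilin_ext f u v = \sum_(w1 <- d1) \sum_(w2 <- d2) (u@_w1 * v@_w2) *: f w1 w2.
Proof.
move=> ud vd; rewrite /bilin_ext (big_fset_incl _ ud) /=; last first.
  by move=> w _ /mcoeff_outdom ->; rewrite big1 // => w2 _; rewrite mul0r scale0r.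
apply: eq_bigr => w _; rewrite (big_fset_incl _ vd) //.
by move=> w2 _ /mcoeff_outdom ->; rewrite mulr0 scale0r.
Qed.

Lemma bilin_extPl f (a : Qt) (u u' v : ht) :
  bilin_ext f (a *: u + u') v = a *: bilin_ext f u v + bilin_ext f u' v.
Proof.
pose d := (msupp u `|` msupp u')%fset.
have ud : (msupp u `<=` d)%fset by exact: fsubsetUl.
have u'd : (msupp u' `<=` d)%fset by exact: fsubsetUr.
have sd : (msupp (a *: u + u') `<=` d)%fset.
  apply: fsubset_trans (msuppD_le _ _) _; rewrite fsubUset u'd andbT.
  exact: fsubset_trans (msuppZ_le _ _) ud.
have vv := fsubset_refl (msupp v).
rewrite (bilin_extEw _ sd vv) (bilin_extEw _ ud vv) (bilin_extEw _ u'd vv).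
rewrite scaler_sumr -big_split; apply: eq_bigr => w1 _ /=.
rewrite scaler_sumr -big_split; apply: eq_bigr => w2 _ /=.
by rewrite mcoeffD mcoeffZ mulrDl scalerDl scalerA mulrA.
Qed.

Lemma bilin_extPr f (a : Qt) (u v v' : ht) :
  bilin_ext f u (a *: v + v') = a *: bilin_ext f u v + bilin_ext f u v'.
Proof.
pose d := (msupp v `|` msupp v')%fset.
have vd : (msupp v `<=` d)%fset by exact: fsubsetUl.
have v'd : (msupp v' `<=` d)%fset by exact: fsubsetUr.
have sd : (msupp (a *: v + v') `<=` d)%fset.
  apply: fsubset_trans (msuppD_le _ _) _; rewrite fsubUset v'd andbT.
  exact: fsubset_trans (msuppZ_le _ _) vd.
have uu := fsubset_refl (msupp u).
rewrite (bilin_extEw _ uu sd) (bilin_extEw _ uu vd) (bilin_extEw _ uu v'd).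
rewrite scaler_sumr -big_split; apply: eq_bigr => w1 _ /=.
rewrite scaler_sumr -big_split; apply: eq_bigr => w2 _ /=.
by rewrite mcoeffD mcoeffZ mulrDr scalerDl scalerA mulrCA.
Qed.

Lemma bilin_extUU f (w1 w2 : word) : bilin_ext f << w1 >> << w2 >> = f w1 w2.
Proof.
by rewrite /bilin_ext !msuppU1 !big_seq_fset1 !mcoeffUU mulr1 scale1r.
Qed.

Lemma stuffle_rec_nil c ks : stuffle_rec c ks [::] = zprod ks.
Proof. by case: ks. Qed.

Lemma bilin_stuffle_rules (c : seq nat -> seq nat -> Qt) (cw : word -> word -> Qt) :
  (forall w1 w2, word1 w1 -> word1 w2 -> c (indices w1) (indices w2) = cw w1 w2) ->
  stuffle_rules cw (bilin_ext (stuffle_word c)).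
Proof.
move=> cE; split=> [a u u' v _ _ _|a u v v' _ _ _|w /in_ht1UP w1|w /in_ht1UP w1|].
- exact: bilin_extPl.
- exact: bilin_extPr.
- by rewrite oneU bilin_extUU /stuffle_word w1 /= zprod_indices.
- by rewrite oneU bilin_extUU /stuffle_word w1 /= stuffle_rec_nil zprod_indices.
move=> k l w1 w2 k0 l0 /in_ht1UP w11 /in_ht1UP w21.
move: (bilin_ext _) (bilin_extUU (stuffle_word c)) => f fE.
move: (z k * << w1 >>) (z l * << w2 >>) (zM k w1) (zM l w2) => _ _ -> ->.
rewrite !fE /stuffle_word.
rewrite !word1_zcons // w11 w21 /= !indices_zcons // -cE //=.
set r := stuffle_rec c (indices w1) (indices w2).
by rewrite [X in _ + X = _]mulrDl -!scalerAl addrA.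
Qed.

Lemma stuffle_zz_word (cw : word -> word -> Qt) (f : ht -> ht -> ht) k l w1 w2 :
  stuffle_rules cw f -> (0 < k)%N -> (0 < l)%N -> word1 w1 -> word1 w2 ->
  f << zcons k w1 >> << zcons l w2 >>
  = z k * f << w1 >> << zcons l w2 >> + z l * f << zcons k w1 >> << w2 >>
    + (1 - 2%:R * t) *: (z (k + l) * f << w1 >> << w2 >>)
    + cw w1 w2 *: (xh ^+ (k + l) * f << w1 >> << w2 >>).
Proof.
move=> fP k0 l0 /in_ht1U w11 /in_ht1U w21.
have := stuffle_zz fP k0 l0 w11 w21.
by case: (z k * _) / (esym (zM k w1)); case: (z l * _) / (esym (zM l w2)).
Qed.

Lemma stuffle_rules_uniq (c : word -> word -> Qt) (f g : ht -> ht -> ht) :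
  stuffle_rules c f -> stuffle_rules c g ->
  forall u v, in_ht1 u -> in_ht1 v -> f u v = g u v.
Proof.
move=> fP gP.
have h0l h v : stuffle_rules c h -> in_ht1 v -> h 0 v = 0.
  move=> hP v1; have := stuffle_linl hP (-1) in_ht10 in_ht10 v1.
  by rewrite scaler0 addr0 scaleN1r addNr.
have h0r h u : stuffle_rules c h -> in_ht1 u -> h u 0 = 0.
  move=> hP u1; have := stuffle_linr hP (-1) u1 in_ht10 in_ht10.
  by rewrite scaler0 addr0 scaleN1r addNr.
have fgz ks ls : all (leq 1) ks -> all (leq 1) ls ->
    f << zword ks >> << zword ls >> = g << zword ks >> << zword ls >>.
  have z1 hs : in_ht1 << zword hs >> by apply/in_ht1UP/word1_zword.
  elim: ks ls => [|k ks IHk] ls /=.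
    by move=> _ _; rewrite -oneU (stuffle_1w fP) // (stuffle_1w gP).
  case/andP=> k0 ks0; elim: ls => [|l ls IHl] /=.
    move=> _; rewrite -oneU (stuffle_w1 fP) ?(stuffle_w1 gP) //;
    exact: (z1 (k :: ks)).
  case/andP=> l0 ls0; have := word1_zword ks; have := word1_zword ls => ls1 ks1.
  have E1 := IHk (l :: ls) ks0; rewrite /= l0 in E1.
  have E2 := IHl ls0; have E3 := IHk ls ks0 ls0; move: (E1 ls0) E2 E3 => /=.
  rewrite (stuffle_zz_word fP k0 l0 ks1 ls1) (stuffle_zz_word gP k0 l0 ks1 ls1).
  by move=> -> -> ->.
have fgw w1 w2 : word1 w1 -> word1 w2 -> f << w1 >> << w2 >> = g << w1 >> << w2 >>.
  by move=> w11 w21; rewrite -(indicesK w11) -(indicesK w21) fgz // indices_gt0.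
have fgl u w2 : in_ht1 u -> word1 w2 -> f u << w2 >> = g u << w2 >>.
  move=> /in_ht1P u1 w21; have w2h := in_ht1U w21.
  suff [] : f u << w2 >> = g u << w2 >> /\ in_ht1 u by [].
  rewrite (monalgE u) big_seq.
  elim/big_rec: _ => [|w x wu [IHx x1]]; first by rewrite !h0l //; split; last exact: in_ht10.
  have w1 := u1 w wu; rewrite malgUZ; split.
    by rewrite (stuffle_linl fP) ?(stuffle_linl gP) ?fgw ?IHx //; apply: in_ht1U.
  by apply: in_ht1D => //; apply/in_ht1Z/in_ht1U.
move=> u v u1 /in_ht1P v1.
suff [] : f u v = g u v /\ in_ht1 v by [].
rewrite (monalgE v) big_seq.
elim/big_rec: _ => [|w x wv [IHx x1]]; first by rewrite !h0r //; split; last exact: in_ht10.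
have w1 := v1 w wv; rewrite malgUZ; split.
  by rewrite (stuffle_linr fP) ?(stuffle_linr gP) ?fgl ?IHx //; apply: in_ht1U.
by apply: in_ht1D => //; apply/in_ht1Z/in_ht1U.
Qed.

Lemma tstuffleP : stuffle_rules (fun w1 w2 => coef_st w1 w2) tstuffle.
Proof.
apply: bilin_stuffle_rules => w1 w2 w11 w21.
by rewrite /coef_st !delta_indices.
Qed.

Lemma tstuffleoP : stuffle_rules (fun w1 w2 => coef_sto w1 w2) tstuffleo.
Proof. exact: bilin_stuffle_rules. Qed.

Lemma stuffle_rec_ht1 ks ls : in_ht1 (stuffle_rec (@coef_st nat) ks ls).
Proof.
pose Y (u : ht) := exists v, u = v * yh.
have YD u v : Y u -> Y v -> Y (u + v).
  by move=> [u' ->] [v' ->]; exists (u' + v'); rewrite mulrDl.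
have YM a u : Y u -> Y (a * u) by move=> [u' ->]; exists (a * u'); rewrite mulrA.
have YZ a u : Y u -> Y (a *: u).
  by move=> [u' ->]; exists (a *: u'); rewrite scalerAl.
have Yz k : Y (z k) by exists (xh ^+ k.-1).
have Yzprod k hs : Y (zprod (k :: hs)).
  elim: hs k => [|h hs IHhs] k; rewrite zprod_cons; last exact/YM/IHhs.
  by rewrite /zprod big_nil mulr1.
suff Yrec : ~~ (nilp ks && nilp ls) -> Y (stuffle_rec (@coef_st nat) ks ls).
  case: (boolP (nilp ks && nilp ls)) => [|/Yrec[v ->]].
    by case: ks ls {Yrec} => [|//] [|//] _ /=; rewrite zprodE; apply: in_ht1U.
  by exists 0, v; rewrite malgC0E add0r.
elim: ks ls => [|k ks IHk] [|l ls] //= _.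
elim: ls l => [|l' ls IHl] l; (apply: (YD); [apply: (YD)|]).
- by apply/YM/IHk; rewrite andbF.
- exact/YM/Yzprod.
- case: ks IHk => [|k' ks] IHk; last exact/YM/IHk.
  rewrite /coef_st /delta /= mulr1 subrr mul0r scale0r addr0 /zprod big_nil mulr1.
  exact: YZ.
- by apply/YM/IHk; rewrite andbF.
- exact/YM/IHl.
- by apply/YM/IHk; rewrite andbF.
Qed.

(* The product [tstuffleo] need not preserve ht1, since x^(k+l) may come last. *)
Lemma tstuffle_ht1 (u v : ht) : in_ht1 (tstuffle u v).
Proof.
rewrite /tstuffle /bilin_ext.
elim/big_rec: _ => [|w1 x _ x1]; first exact: in_ht10.
apply: in_ht1D => //; elim/big_rec: _ => [|w2 y _ y1]; first exact: in_ht10.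
apply: in_ht1D => //; apply: in_ht1Z; rewrite /stuffle_word.
by case: ifP => _; [exact: stuffle_rec_ht1|exact: in_ht10].
Qed.

Lemma indices_zword ks : all (leq 1) ks -> indices (zword ks) = ks.
Proof.
elim: ks => [|k ks IHks] //= /andP[k0 /IHks ksE].
by rewrite indices_zcons // ksE.
Qed.

Lemma tstuffle_zprod ks ls : all (leq 1) ks -> all (leq 1) ls ->
  tstuffle (zprod ks) (zprod ls) = stuffle_rec (@coef_st nat) ks ls.
Proof.
move=> ks0 ls0; rewrite !zprodE [LHS]bilin_extUU /stuffle_word.
by rewrite !word1_zword !indices_zword.
Qed.

Lemma tstuffleo_zprod ks ls : all (leq 1) ks -> all (leq 1) ls ->
  tstuffleo (zprod ks) (zprod ls) = stuffle_rec (@coef_sto nat) ks ls.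
Proof.
move=> ks0 ls0; rewrite !zprodE [LHS]bilin_extUU /stuffle_word.
by rewrite !word1_zword !indices_zword.
Qed.

(* Main.v *)
(* Sort the words of the product according to the number i of letters
   z_{l_1}, ..., z_{l_i} consumed when z_{k_j} is placed: as long as z_{k_j} is
   still to come, the left tail is nonempty, so delta vanishes and the rules are
   those of the o-product. The terms for a given i therefore satisfy the
   recursion of the product itself, and the formula follows by induction on
   j and n. *)
Require Import Defs.
From mathcomp Require Import all_boot all_order all_algebra.
From mathcomp Require Import finmap.
From mathcomp.multinomials Require Import monalg.
Import GRing.Theory.
Local Open Scope ring_scope.

Set Implicit Arguments.
Unset Strict Implicit.
Unset Printing Implicit Defensive.

(* Stated over an abstract ring because rewriting with ring laws directly in
   [ht] makes unification diverge.  Here [e ks ls r] is the element by which two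
   first letters of indices summing to r are merged in front of the tails ks
   and ls. *)
Definition quasi_shuffle (R : nzRingType) (x : nat -> R)
    (e : seq nat -> seq nat -> nat -> R) (s : seq nat -> seq nat -> R) : Prop :=
  [/\ forall ls, s [::] ls = \prod_(l <- ls) x l,
      forall ks, s ks [::] = \prod_(k <- ks) x k
    & forall k ks l ls, s (k :: ks) (l :: ls)
        = x k * s ks (l :: ls) + x l * s (k :: ks) ls + e ks ls (k + l)%N * s ks ls].

(* The terms in which the letter k, standing between ks1 and ks2, is preceded
   by exactly i letters of ls, or is merged with the i-th of them. *)
Definition split_term (R : nzRingType) (x : nat -> R)
    (e : seq nat -> seq nat -> nat -> R) (so s : seq nat -> seq nat -> R)
    (k : nat) (ks2 ks1 ls : seq nat) (i : nat) : R :=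
  (so ks1 (take i ls) * x k
   + (if i is i'.+1 then
        so ks1 (take i' ls) * e ks2 (drop i ls) (k + nth 0%N ls i')%N
      else 0))
  * s ks2 (drop i ls).

Lemma split_term_cons0 (R : nzRingType) (x : nat -> R) eo so :
  quasi_shuffle x eo so ->
  forall e s k ks2 k1 ks1 ls,
  split_term x e so s k ks2 (k1 :: ks1) ls 0
  = x k1 * split_term x e so s k ks2 ks1 ls 0.
Proof.
by case=> _ so0 _ *; rewrite /split_term !take0 !so0 big_cons !addr0 -!mulrA.
Qed.

(** Both values of [so] expand by its recursion, while the factor [s ks2 _] is untouched. As [eo]
    ignores the tails, truncating [ls] by [take] does not change the merging element. *)
Lemma split_term_consS (R : nzRingType) (x : nat -> R) eo so :
  quasi_shuffle x eo so -> (forall ks' ls', eo ks' ls' = eo [::] [::]) ->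
  forall e s k ks2 k1 ks1 l ls i,
  split_term x e so s k ks2 (k1 :: ks1) (l :: ls) i.+1
  = x k1 * split_term x e so s k ks2 ks1 (l :: ls) i.+1
    + x l * split_term x e so s k ks2 (k1 :: ks1) ls i
    + eo [::] [::] (k1 + l)%N * split_term x e so s k ks2 ks1 ls i.
Proof.
case=> _ so0 soS eoE e s k ks2 k1 ks1 l ls i.
rewrite /split_term /= soS eoE !mulrA -!mulrDl.
congr (_ * _); rewrite !mulrDr !mulrDl !mulrA.
(* For [i = 0] the letter [k] merges with [l] itself: [so] has an empty second argument there and is
   a plain product. *)
case: i => [|i].
  rewrite !mulr0 !addr0 !take0 !so0 big_cons !mulrA.
  by rewrite -!addrA; congr (_ + _); rewrite addrA addrC.
by rewrite /= soS eoE !mulrDl !mulrA addrACA (addrACA (_ * _ * _)).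
Qed.

Lemma split_term_nil0 (R : nzRingType) (x : nat -> R) eo so :
  quasi_shuffle x eo so ->
  forall e s k ks2 ls,
  split_term x e so s k ks2 [::] ls 0 = x k * s ks2 ls.
Proof.
by case=> so0 _ _ *; rewrite /split_term take0 drop0 addr0 so0 big_nil mul1r.
Qed.

(** With nothing to shuffle before [k], the letter [l] factors out on the left, except when it
    merges with [k], which gives the extra term at [i = 0]. *)
Lemma split_term_nilS (R : nzRingType) (x : nat -> R) eo so :
  quasi_shuffle x eo so ->
  forall e s k ks2 l ls i,
  split_term x e so s k ks2 [::] (l :: ls) i.+1
  = x l * split_term x e so s k ks2 [::] ls i
    + (if i is 0 then e ks2 ls (k + l)%N * s ks2 ls else 0).
Proof.
case=> so0 _ _ e s k ks2 l ls i; rewrite /split_term /= !so0 (mulrA (x l)).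
case: i => [|i].
  by rewrite !take0 !drop0 addr0 big_cons !big_nil !mul1r !mulr1 mulrDl.
by rewrite addr0 /= !so0 !big_cons mulrDr !mulrA.
Qed.

Lemma quasi_shuffle_split (R : nzRingType) (x : nat -> R) eo e so s k ks1 ks2 ls :
  quasi_shuffle x eo so -> quasi_shuffle x e s ->
  (forall ks' ls', eo ks' ls' = eo [::] [::]) ->
  (forall k' ks' ls', e (k' :: ks') ls' = eo [::] [::]) ->
  s (ks1 ++ k :: ks2) ls
  = \sum_(0 <= i < (size ls).+1) split_term x e so s k ks2 ks1 ls i.
Proof.
move=> soP sP eoE eE; have [_ s0 sS] := sP.
elim: ks1 ls => [|k1 ks1 IHk] ls.
  elim: ls => [|l ls IHl].
    by rewrite big_nat1 (split_term_nil0 soP) !s0 big_cons.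
  rewrite /= in IHl *.
  rewrite sS big_nat_recl // (split_term_nil0 soP).
  rewrite -addrA; congr (_ + _).
  under eq_bigr do rewrite (split_term_nilS soP).
  rewrite big_split -mulr_sumr -IHl; congr (_ + _).
  by rewrite /= big_nat_recl //= big1 ?addr0.
elim: ls => [|l ls IHl].
  have := IHk [::]; rewrite !big_nat1 (split_term_cons0 soP) => <-.
  by rewrite !s0 big_cons.
rewrite /= in IHl *.
rewrite sS big_nat_recl // (split_term_cons0 soP).
under eq_bigr do rewrite (split_term_consS soP eoE).
(* The sums led by [x l] and by [eo] close by induction; the isolated term of index 0 completes the
   one led by [x k1]. *)
rewrite !big_split /= -!mulr_sumr -IHl -IHk !addrA -mulrDr.
rewrite IHk big_nat_recl //; congr (_ + _ * _).
(* The left tail [ks1 ++ k :: ks2] is nonempty, so [e] agrees with [eo]. *)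
by case: (ks1) => [|? ?]; rewrite ?eE.
Qed.

Definition merge_coef (c : Qt) (r : nat) : ht :=
  (1 - 2%:R * t) *: z r + c *: xh ^+ r.

Lemma stuffle_rec_quasi_shuffle (c : seq nat -> seq nat -> Qt) :
  quasi_shuffle z (fun ks ls => merge_coef (c ks ls)) (stuffle_rec c).
Proof. by split=> // -[]. Qed.

(** [coef_sto] is constant, and [coef_st] takes the same value on a nonempty left tail, where
    [delta] vanishes. *)
Lemma stuffle_rec_split k ks1 ks2 ls :
  stuffle_rec (@coef_st nat) (ks1 ++ k :: ks2) ls
  = \sum_(0 <= i < (size ls).+1)
      split_term z (fun ks' ls' => merge_coef (coef_st ks' ls'))
        (stuffle_rec (@coef_sto nat)) (stuffle_rec (@coef_st nat)) k ks2 ks1 ls i.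
Proof.
have soP := stuffle_rec_quasi_shuffle (@coef_sto nat).
have sP := stuffle_rec_quasi_shuffle (@coef_st nat).
apply: (quasi_shuffle_split k ks1 ks2 ls soP sP) => [ks' ls'|k' ks' ls']; first by [].
by rewrite /coef_st /delta mul0r subr0 mul1r.
Qed.

Lemma index_iota_split a b j : (a <= j < b)%N ->
  index_iota a b = index_iota a j ++ j :: index_iota j.+1 b.
Proof.
case/andP=> aj jb; rewrite /index_iota -[j :: _]/(iota j (b - j.+1).+1) subnSK //.
rewrite -{2}(subnKC aj) -iotaD.
by rewrite addnC addnBA // (subnK (ltnW jb)).
Qed.

Lemma zsegE k a b : (a <= b)%N -> zseg k a b = zprod (map k (index_iota a b)).
Proof. by move=> ab; rewrite /zseg ltnNge ab /= /zprod big_map. Qed.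

Lemma tstuffleo0r (u : ht) : tstuffleo u 0 = 0.
Proof. by rewrite /tstuffleo /bilin_ext big1 // => w _; rewrite msupp0 big_nil. Qed.

Theorem proposition2 (m n : nat) (k l : nat -> nat)
    (hm : (0 < m)%N) (hn : (0 < n)%N)
    (hk : forall i : nat, (1 <= i <= m)%N -> (0 < k i)%N)
    (hl : forall i : nat, (1 <= i <= n)%N -> (0 < l i)%N)
    (j : nat) (hj : (1 <= j <= m)%N) :
  tstuffle (zseg k 1 m.+1) (zseg l 1 n.+1) =
  \sum_(0 <= i < n.+1)
    (tstuffleo (zseg k 1 j) (zseg l 1 i.+1) * z (k j)
     + tstuffleo (zseg k 1 j) (zseg l 1 i)
       * ((1 - 2%:R * t) *: z (k j + l i)
          + ((1 - (i == n)%:R * (j == m)%:R) * (t ^+ 2 - t))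
            *: xh ^+ (k j + l i)))
    * tstuffle (zseg k j.+1 m.+1) (zseg l i.+1 n.+1).
Proof.
case/andP: hj => j0 jm.
(* Only lists of positive indices are recovered by [indices] from their words. *)
have gt0 (f : nat -> nat) a b N : (0 < a)%N -> (b <= N.+1)%N ->
    (forall i, (1 <= i <= N)%N -> (0 < f i)%N) ->
    all (leq 1) (map f (index_iota a b)).
  move=> a0 bN fP; apply/allP => _ /mapP[i + ->]; rewrite mem_index_iota.
  case/andP=> ai ib; apply: fP; rewrite (leq_trans a0 ai) -ltnS.
  exact: leq_trans ib bN.
pose ls := map l (index_iota 1 n.+1).
have takeE i : (i <= n)%N -> take i ls = map l (index_iota 1 i.+1).
  by move=> iN; rewrite -map_take take_iota /index_iota !subSS !subn0 (minn_idPl iN).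
have dropE i : drop i ls = map l (index_iota i.+1 n.+1).
  by rewrite -map_drop drop_iota /index_iota subn1 subSS add1n.
have stoE i : (i <= n)%N -> tstuffleo (zseg k 1 j) (zseg l 1 i.+1)
    = stuffle_rec (@coef_sto nat) (map k (index_iota 1 j)) (take i ls).
  move=> iN; rewrite takeE // !zsegE // tstuffleo_zprod //.
    exact: (gt0 k _ _ m _ (leqW jm)).
  exact: (gt0 l _ _ n).
have stE i : (i <= n)%N -> tstuffle (zseg k j.+1 m.+1) (zseg l i.+1 n.+1)
    = stuffle_rec (@coef_st nat) (map k (index_iota j.+1 m.+1)) (drop i ls).
  move=> iN; rewrite dropE // !zsegE // tstuffle_zprod //.
    exact: (gt0 k _ _ m).
  exact: (gt0 l _ _ n).
have -> : tstuffle (zseg k 1 m.+1) (zseg l 1 n.+1)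
    = stuffle_rec (@coef_st nat) (map k (index_iota 1 m.+1)) ls.
  rewrite !zsegE // tstuffle_zprod //; first exact: (gt0 k _ _ m).
  exact: (gt0 l _ _ n).
rewrite (@index_iota_split 1 m.+1 j) ?j0 // map_cat [map _ (_ :: _)]/=.
rewrite stuffle_rec_split.
have size_ls : size ls = n by rewrite size_map size_iota subn1.
rewrite size_ls.
apply: eq_big_nat => i; rewrite ltnS => /andP[_ iN].
rewrite (stE i iN) (stoE i iN) /split_term.
congr ((_ + _) * _); case: i iN => [|i] iN.
  (* The segment [zseg l 1 0] is 0 by convention, not the empty product 1. *)
  by rewrite [zseg l 1 0]/= tstuffleo0r mul0r.
rewrite (stoE i (ltnW iN)) /merge_coef /coef_st /delta.
have -> : nth 0%N ls i = l i.+1.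
  by rewrite (nth_map 0%N) ?size_iota ?subn1 // nth_iota ?subn1 // add1n.
(* The two [delta] factors become Kronecker symbols: each tail is empty exactly when its last letter
   has been used. *)
have -> : nilp (drop i.+1 ls) = (i.+1 == n).
  by rewrite /nilp size_drop size_ls subn_eq0 eqn_leq iN.
have -> : nilp (map k (index_iota j.+1 m.+1)) = (j == m).
  by rewrite /nilp size_map size_iota subSS subn_eq0 eqn_leq jm.
by rewrite (@mulrC Qt (j == m)%:R).
Qed.
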